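(* Let $(\Phi,\mathcal T,d,\downarrow,\otimes,\le)$ be an adjoint information algebra over a topological space $(X,\mathcal T)$ with $X$ finite, let $K=\{\phi_1,\dots,\phi_n\}\subseteq\Phi$ be a finite set of valuations, and let $\gamma=\phi_1\otimes\cdots\otimes\phi_n$. Then $K$ agrees globally if and only if $\gamma^{\downarrow d\phi_i}=\phi_i$ for all $1\le i\le n$. In this case $\gamma$ is the greatest truth valuation for $K$, i.e. $\gamma$ is a truth valuation for $K$ and $\delta\le\gamma$ for every truth valuation $\delta$ for $K$.
   Context: An information algebra over $(X,\mathcal T)$ is a quintuple $(\Phi,\mathcal T,d,\downarrow,\otimes)$: a set $\Phi$ (valuations), a labelling $d:\Phi\to\mathcal T$, a projection $(\phi,U)\mapsto\phi^{\downarrow U}$ defined when $U\subseteq d\phi$, and a binary combination $\otimes$ on $\Phi$, with $\Phi_U\defeq\{\phi:d\phi=U\}$, satisfying: (I1) $\otimes$ is associative and commutative; (I2) $d(\phi^{\downarrow U})=U$; (I3) $(\phi^{\downarrow U})^{\downarrow W}=\phi^{\downarrow W}$ for $W\subseteq U\subseteq d\phi$; (I4) $\phi^{\downarrow d\phi}=\phi$; (I5) $d(\phi\otimes\psi)=d\phi\cup d\psi$; (I6) if $U=d\phi$, $W=d\psi$ and $Q\in\mathcal T$ with $U\subseteq Q\subseteq U\cup W$, then $(\phi\otimes\psi)^{\downarrow Q}=\phi\otimes\psi^{\downarrow Q\cap W}$; (I7) for each $U$ there is $1_U\in\Phi_U$ with $\phi\otimes 1_U=1_U\otimes\phi=\phi$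 for $\phi\in\Phi_U$, and $1_U\otimes 1_W=1_{U\cup W}$; (I8) for each $U$ there is $0_U\in\Phi_U$ with $\phi\otimes 0_U=0_U\otimes\phi=0_U$, and for $W\subseteq U$, $\phi\in\Phi_U$: $\phi^{\downarrow W}=0_W\iff\phi=0_U$; (I9) $\phi\otimes\phi^{\downarrow U}=\phi$ for $U\subseteq d\phi$. It is ordered if $\le$ is a partial order on $\Phi$ with: (O1) $\phi\le\psi$ implies $d\phi=d\psi$, and every subset of each $\Phi_U$ has an infimum; (O2) $\inf\Phi_U=0_U$; (O3) $\phi_1\le\phi_2$, $\psi_1\le\psi_2$ imply $\phi_1\otimes\psi_1\le\phi_2\otimes\psi_2$; (O4) $\phi\le\psi$ implies $\phi^{\downarrow U}\le\psi^{\downarrow U}$. It is adjoint if moreover for all $U,W\in\mathcal T$: $\phi\le\phi^{\downarrow U}\otimes\phi^{\downarrow W}$ for all $\phi\in\Phi_{U\cup W}$, and $(\phi\otimes\psi)^{\downarrow U}\le\phi$, $(\phi\otimes\psi)^{\downarrow W}\le\psi$ for all $\phi\in\Phi_U$, $\psi\in\Phi_W$ (i.e. $\otimes:\Phi_U\times\Phi_W\to\Phi_{U\cup W}$ is right adjoint to $\phi\mapsto(\phi^{\downarrow U},\phi^{\downarrow W})$). A truth valuation for $K=\{\phi_1,\dots,\phi_n\}$ is some $\delta\in\Phi_{U}$ with $U=\bigcup_i d\phi_i$ and $\delta^{\downarrow d\phi_i}=\phi_i$ for all $i$; $K$ agrees globally iff a truth valuation for $K$ exists. *)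

(* Defs.v *)
From HB Require Import structures.
From mathcomp Require Import all_boot all_order.
From mathcomp Require Import boolp classical_sets functions cardinality.
From mathcomp Require Import topology.

Set Implicit Arguments.
Unset Strict Implicit.
Unset Printing Implicit Defensive.

Local Open Scope classical_set_scope.
Local Open Scope order_scope.

(* Labels are the open sets of X, represented as U : set X with open U.
   Projection, units and zeros are total functions, but the axioms constrain
   project phi U only for U open with U `<=` label phi, and neutral U (the unit
   on U) and null U (the zero on U) only for U open. *)
Record info_algebra (X : topologicalType) (Phi : Type) := InfoAlgebra {
  label : Phi -> set X;
  project : Phi -> set X -> Phi;
  combine : Phi -> Phi -> Phi;
  neutral : set X -> Phi;
  null : set X -> Phi;
  label_open : forall phi, open (label phi);
  combineA : associative combine;
  combineC : commutative combine;
  label_project : forall phi U, open U -> U `<=` label phi ->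
    label (project phi U) = U;
  project_project : forall phi U W, open U -> open W ->
    W `<=` U -> U `<=` label phi ->
    project (project phi U) W = project phi W;
  project_label : forall phi, project phi (label phi) = phi;
  label_combine : forall phi psi,
    label (combine phi psi) = label phi `|` label psi;
  project_combine : forall phi psi Q, open Q ->
    label phi `<=` Q -> Q `<=` label phi `|` label psi ->
    project (combine phi psi) Q =
    combine phi (project psi (Q `&` label psi));
  label_neutral : forall U, open U -> label (neutral U) = U;
  combine_neutral : forall phi,
    combine phi (neutral (label phi)) = phi /\
    combine (neutral (label phi)) phi = phi;
  neutral_combine : forall U W, open U -> open W ->
    combine (neutral U) (neutral W) = neutral (U `|` W);
  label_null : forall U, open U -> label (null U) = U;
  combine_null : forall phi,
    combine phi (null (label phi)) = null (label phi) /\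
    combine (null (label phi)) phi = null (label phi);
  project_null : forall phi W, open W -> W `<=` label phi ->
    (project phi W = null W <-> phi = null (label phi));
  combine_project : forall phi U, open U -> U `<=` label phi ->
    combine phi (project phi U) = phi
}.

Section Theory.
Context {X : topologicalType} {Phi : Type} (A : info_algebra X Phi).

Lemma combine_neutral_set0 : left_id (neutral A set0) (combine A).
Proof.
move=> phi; rewrite -[in LHS](combine_neutral A phi).2 combineA.
rewrite neutral_combine ?set0U; [|exact: open0|exact: label_open].
by case: (combine_neutral A phi).
Qed.

(* Hence an iterated combination with neutral A set0 as default value is the
   plain iterated combination when nonempty. *)
HB.instance Definition _ := Monoid.isComLaw.Build
  Phi (neutral A set0) (combine A) (combineA A) (combineC A) combine_neutral_set0.

Definition valuations_on (U : set X) : set Phi := [set phi | label A phi = U].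

Definition truth_valuation (K : set Phi) (delta : Phi) : Prop :=
  label A delta = \bigcup_(phi in K) label A phi /\
  forall phi, K phi -> project A delta (label A phi) = phi.

Definition agrees_globally (K : set Phi) : Prop :=
  exists delta, truth_valuation K delta.

End Theory.

Section Ordered.
Context {X : topologicalType} {disp : Order.disp_t} {Phi : porderType disp}.
Variable A : info_algebra X Phi.

(* Infima are taken in the poset of valuations on U, not in Phi: this matters
   only for S = set0, whose infimum is the greatest valuation on U. *)
Definition is_infimum_on (U : set X) (S : set Phi) (m : Phi) : Prop :=
  let L := valuations_on A U `&` lbound S in L m /\ ubound L m.

Record ordered : Prop := Ordered {
  le_label : forall phi psi : Phi, phi <= psi -> label A phi = label A psi;
  infimum_exists : forall (U : set X) (S : set Phi), open U ->
    S `<=` valuations_on A U -> exists m, is_infimum_on U S m;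
  infimum_valuations_on : forall U, open U ->
    is_infimum_on U (valuations_on A U) (null A U);
  le_combine : forall phi1 phi2 psi1 psi2 : Phi,
    phi1 <= phi2 -> psi1 <= psi2 ->
    combine A phi1 psi1 <= combine A phi2 psi2;
  le_project : forall (phi psi : Phi) (U : set X), phi <= psi ->
    open U -> U `<=` label A phi -> project A phi U <= project A psi U
}.

Record adjoint : Prop := Adjoint {
  adjoint_ordered : ordered;
  adjoint_unit : forall (U W : set X) phi, open U -> open W ->
    valuations_on A (U `|` W) phi ->
    phi <= combine A (project A phi U) (project A phi W);
  adjoint_counit : forall (U W : set X) phi psi, open U -> open W ->
    valuations_on A U phi -> valuations_on A W psi ->
    project A (combine A phi psi) U <= phi /\
    project A (combine A phi psi) W <= psi
}.

End Ordered.

(* Main.v *)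
Require Import Defs.
From HB Require Import structures.
From mathcomp Require Import all_boot all_order.
From mathcomp Require Import boolp classical_sets functions cardinality.
From mathcomp Require Import topology.

(** Idempotence gives [delta = delta ⊗ phi_i] for a truth valuation [delta],
    hence [delta = delta ⊗ gamma], which lies below [gamma] by the counit of the
    adjunction. Projecting, [phi_i <= gamma↓(d phi_i)]; the reverse inequality
    is the counit applied to [gamma = phi_i ⊗ (the other phi_j)]. *)

Local Open Scope classical_set_scope.
Local Open Scope order_scope.

(** Labelling is a monoid morphism from combination to union; the default value [neutral A set0]
    goes to the empty set, which settles [n = 0]. *)
Lemma label_big_combine (X : topologicalType) (Phi : Type)
    (A : info_algebra X Phi) (n : nat) (phi : 'I_n -> Phi) :
  label A (\big[combine A/neutral A set0]_(i < n) phi i) =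
  \bigcup_(psi in [set phi i | i in [set: 'I_n]]) label A psi.
Proof.
rewrite (big_morph _ (label_combine A) (label_neutral A open0)).
rewrite bigcup_image -(@bigcup_seq _ _ (index_enum 'I_n)).
by apply: eq_bigcupl; split=> i //= _; rewrite mem_index_enum.
Qed.

(** The valuations absorbed by [delta] include the unit on [set0] and, by associativity, are closed
    under combination, so it suffices to absorb each [phi i]. *)
Lemma truth_valuation_combine {X : topologicalType} {Phi : Type}
    {A : info_algebra X Phi} {n : nat} {phi : 'I_n -> Phi} {delta : Phi} :
  truth_valuation A [set phi i | i in [set: 'I_n]] delta ->
  combine A delta (\big[combine A/neutral A set0]_(i < n) phi i) = delta.
Proof.
case=> labelD projD; elim/big_ind: _ => [|x y xD yD|i _].
- by rewrite combineC combine_neutral_set0.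
- by rewrite combineA xD yD.
have Ki : [set phi i | i in [set: 'I_n]] (phi i) by exists i.
(* Read as a projection of [delta], the factor [phi i] is absorbed by idempotence. *)
rewrite -{1}(projD _ Ki) combine_project //; first exact: label_open.
by rewrite labelD; exact: bigcup_sup.
Qed.

(** With equal labels, the projection in the counit is onto the full label of the combination, hence
    the identity. *)
Lemma combine_le (X : topologicalType) (disp : Order.disp_t)
    (Phi : porderType disp) (A : info_algebra X Phi) (phi psi : Phi) :
  adjoint A -> label A phi = label A psi -> combine A phi psi <= psi.
Proof.
move=> adjA eqL.
have [_] := adjoint_counit adjA (label_open A phi) (label_open A psi)
  (erefl : valuations_on A _ phi) (erefl : valuations_on A _ psi).
have -> : label A psi = label A (combine A phi psi).
  by rewrite label_combine eqL joinEset setUid.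
by rewrite project_label.
Qed.

Lemma project_big_combine_le (X : topologicalType) (disp : Order.disp_t)
    (Phi : porderType disp) (A : info_algebra X Phi) (n : nat)
    (phi : 'I_n -> Phi) (i : 'I_n) :
  adjoint A ->
  project A (\big[combine A/neutral A set0]_(j < n) phi j) (label A (phi i))
    <= phi i.
Proof.
(* Commutativity lets [phi i] be split off; for [n = 1] the remaining factor is [neutral A set0]. *)
move=> adjA; rewrite (bigD1 i) //=; set rest := \big[_/_]_(_ < _ | _) _.
by have [] := adjoint_counit adjA (label_open A (phi i)) (label_open A rest)
  (erefl : valuations_on A _ (phi i)) (erefl : valuations_on A _ rest).
Qed.

Theorem theorem6 (X : topologicalType) (disp : Order.disp_t)
    (Phi : porderType disp) (A : info_algebra X Phi)
    (finX : finite_set [set: X]) (adjA : adjoint A)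
    (n : nat) (phi : 'I_n -> Phi) :
  let K : set Phi := [set phi i | i in [set: 'I_n]] in
  let gamma : Phi := \big[combine A/neutral A set0]_(i < n) phi i in
  (agrees_globally A K <->
     forall i : 'I_n, project A gamma (label A (phi i)) = phi i) /\
  (agrees_globally A K ->
     truth_valuation A K gamma /\
     forall delta : Phi, truth_valuation A K delta -> delta <= gamma).
Proof.
move=> K gamma.
have labelG : label A gamma = \bigcup_(psi in K) label A psi.
  exact: label_big_combine.
have le_gamma delta : truth_valuation A K delta -> delta <= gamma.
  move=> tD; rewrite -(truth_valuation_combine tD); apply: combine_le => //.
  by rewrite labelG; case: tD.
have projG : agrees_globally A K ->
    forall i, project A gamma (label A (phi i)) = phi i.
  move=> [delta tD] i; have Ki : K (phi i) by exists i.
  apply/Order.POrderTheory.le_anti; rewrite project_big_combine_le //=.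
  (* What remains is [phi i <= project A gamma (label A (phi i))]. Only the left-hand [phi i] is
     rewritten as a projection of [delta], so that monotonicity of projection reduces the claim to
     [delta <= gamma]. *)
  case: (tD) => labelD projD; rewrite -{1}(projD _ Ki).
  apply: (le_project (adjoint_ordered adjA)); first exact: le_gamma.
    exact: label_open.
  by rewrite labelD; exact: bigcup_sup.
have truthG : (forall i, project A gamma (label A (phi i)) = phi i) ->
    truth_valuation A K gamma.
  by move=> projE; split=> // _ [i _ <-].
split; first by split=> // /truthG tG; exists gamma.
by move=> /projG/truthG.
Qed.
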